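(* Let $X$ be a finite set, let $\mathcal{Q}(X)$ be the set of quasigroup structures on $X$, and let $G=\mathrm{Sym}(X)\times\mathrm{Sym}(X)\times\mathrm{Sym}(X)$ act on $\mathcal{Q}(X)$ by isotopy. Let $(Q_t)$ be a continuous-time Markov process on $\mathcal{Q}(X)$ with generator $$(Lf)(Q)=\sum_{R\in\mathcal{Q}(X)} r(Q\to R)\bigl(f(R)-f(Q)\bigr),$$ where $r(Q\to R)\ge 0$ are transition rates. Assume: (1) (Gauge invariance) $r(g\cdot Q\to g\cdot R)=r(Q\to R)$ for all $g\in G$ and all $Q,R\in\mathcal{Q}(X)$; (2) (Mirror-only transitions) $r(Q\to R)=0$ unless $R\in G\cdot Q^{\#}$; (3) (Class-dependent total rate) $k([Q]):=\sum_{R\in G\cdot Q^{\#}} r(Q\to R)$ depends only on the isotopy class $[Q]$. Then the induced process on $\mathcal{Q}(X)/G$ is a well-defined two-state Markov process (transitions occur only between $[Q]$ and $[Q^{\#}]$) with generator $$(\bar L\bar f)([Q])=k([Q])\bigl(\bar f([Q^{\#}])-\bar f([Q])\bigr)$$ for any function $\bar f:\mathcal{Q}(X)/G\to\mathbb{R}$.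
   Context: A quasigroup structure on $X$ is a binary operation $\cdot:X\times X\to X$ such that $(X,\cdot)$ is a quasigroup (all left and right translations are bijections). Isotopy action: for $g=(\alpha,\beta,\gamma)\in G$ and $Q=(X,\cdot)$, $g\cdot Q=(X,\ast)$ with $x\ast y:=\gamma(\alpha^{-1}(x)\cdot\beta^{-1}(y))$. The orbit $G\cdot Q$ is the isotopy class of $Q$, denoted $[Q]$ as an element of $\mathcal{Q}(X)/G$. The mirror of $Q=(X,\cdot)$ is $Q^{\#}:=(X,\diamond)$ with $x\diamond y:=y\cdot x$; the map $[Q]\mapsto[Q^{\#}]$ is a well-defined involution on $\mathcal{Q}(X)/G$. A function $f:\mathcal{Q}(X)\to\mathbb{R}$ is isotopy invariant if $f(g\cdot Q)=f(Q)$ for all $g\in G$; such functions correspond to functions $\bar f$ on $\mathcal{Q}(X)/G$ via $f(Q)=\bar f([Q])$, and the induced operator $\bar L$ is given by $(\bar L\bar f)([Q])=(Lf)(Q)$. *)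

(* Defs.v *)
From HB Require Import structures.
From mathcomp Require Import all_boot all_order all_algebra all_fingroup.
From mathcomp Require Import all_classical all_reals all_analysis.

Set Implicit Arguments.
Unset Strict Implicit.
Unset Printing Implicit Defensive.

Import Order.TTheory GRing.Theory Num.Theory.
Import numFieldNormedType.Exports.
Local Open Scope ring_scope.

Section Quasigroups.
Variable X : finType.

Definition quasigroup_axiom (m : {ffun X * X -> X}) : bool :=
  `[< (forall x, bijective (fun y => m (x, y))) /\
      (forall y, bijective (fun x => m (x, y))) >].

Record quasigroup := Quasigroup {
  qop : {ffun X * X -> X};
  qopP : quasigroup_axiom qop }.

HB.instance Definition _ := [isSub for qop].
HB.instance Definition _ := [Countable of quasigroup by <:].
HB.instance Definition _ := [Finite of quasigroup by <:].

Definition qmul (Q : quasigroup) (x y : X) : X := qop Q (x, y).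

Lemma qmul_inj (Q1 Q2 : quasigroup) :
  (forall x y, qmul Q1 x y = qmul Q2 x y) -> Q1 = Q2.
Proof. by move=> e; apply: val_inj; apply/ffunP => -[x y]; apply: e. Qed.

Definition isogroup : finGroupType := ({perm X} * {perm X} * {perm X})%type.

Definition isotope_op (Q : quasigroup) (g : isogroup) : {ffun X * X -> X} :=
  [ffun p => g.2 (qmul Q ((g.1.1)^-1%g p.1) ((g.1.2)^-1%g p.2))].

Fact isotope_subproof Q g : quasigroup_axiom (isotope_op Q g).
Proof.
have /asboolP[ml mr] := qopP Q; case: g => -[a b] c; apply/asboolP; split.
- move=> x; have [h hK Kh] := ml (a^-1%g x).
  exists (fun z => b (h (c^-1%g z))) => y; rewrite ffunE /qmul /=.
    by rewrite permK hK permKV.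
  by rewrite permK Kh permKV.
- move=> y; have [h hK Kh] := mr (b^-1%g y).
  exists (fun z => a (h (c^-1%g z))) => x; rewrite ffunE /qmul /=.
    by rewrite permK hK permKV.
  by rewrite permK Kh permKV.
Qed.

Definition isotope (Q : quasigroup) (g : isogroup) : quasigroup :=
  Quasigroup (isotope_subproof Q g).

Lemma isotopeE Q g x y :
  qmul (isotope Q g) x y =
  g.2 (qmul Q ((g.1.1)^-1%g x) ((g.1.2)^-1%g y)).
Proof. by rewrite {1}/qmul ffunE. Qed.

Fact isotope1 : isotope^~ 1%g =1 id.
Proof. by move=> Q; apply: qmul_inj => x y; rewrite isotopeE /= invg1 !perm1. Qed.

Fact isotopeM Q g h : isotope Q (g * h)%g = isotope (isotope Q g) h.
Proof. by apply: qmul_inj => x y; rewrite !isotopeE /= !invMg !permM. Qed.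

(* Actions are on the right in MathComp, and [(s * t)%g] applies the
   permutation [s] first; so this is the left action of Sym(X)^3 in which
   products are compositions of functions. *)
Definition isotopy : {action isogroup &-> quasigroup} :=
  TotalAction isotope1 isotopeM.

Definition isotopy_orbit (Q : quasigroup) : {set quasigroup} :=
  orbit isotopy [set: isogroup] Q.

Definition mirror_op (Q : quasigroup) : {ffun X * X -> X} :=
  [ffun p => qmul Q p.2 p.1].

Fact mirror_subproof Q : quasigroup_axiom (mirror_op Q).
Proof.
have /asboolP[ml mr] := qopP Q; apply/asboolP; split=> x.
- by apply: (eq_bij (mr x)) => y; rewrite ffunE.
- by apply: (eq_bij (ml x)) => y; rewrite ffunE.
Qed.

Definition mirror (Q : quasigroup) : quasigroup :=
  Quasigroup (mirror_subproof Q).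

Lemma mirrorE Q x y : qmul (mirror Q) x y = qmul Q y x.
Proof. by rewrite {1}/qmul ffunE. Qed.

Lemma mirrorK : involutive mirror.
Proof. by move=> Q; apply: qmul_inj => x y; rewrite !mirrorE. Qed.

Lemma mirror_isotope Q (a b c : {perm X}) :
  mirror (isotope Q (a, b, c)) = isotope (mirror Q) (b, a, c).
Proof. by apply: qmul_inj => x y; rewrite !(mirrorE, isotopeE). Qed.

Record isoclass := Isoclass {
  isoclass_set : {set quasigroup};
  isoclassP : isoclass_set \in [set isotopy_orbit Q | Q : quasigroup] }.

HB.instance Definition _ := [isSub for isoclass_set].
HB.instance Definition _ := [Countable of isoclass by <:].
HB.instance Definition _ := [Finite of isoclass by <:].

Fact isocl_subproof Q :
  isotopy_orbit Q \in [set isotopy_orbit Q' | Q' : quasigroup].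
Proof. exact: imset_f. Qed.

Definition isocl (Q : quasigroup) : isoclass := Isoclass (isocl_subproof Q).

Lemma mirror_orbit Q : mirror @: isotopy_orbit Q = isotopy_orbit (mirror Q).
Proof.
apply/setP => R; apply/imsetP/idP.
- case=> S /orbitP[[[a b] c] _ <-] ->.
  by apply/orbitP; exists (b, a, c); rewrite ?inE //= mirror_isotope.
- case/orbitP=> -[[a b] c] _ <- /=.
  exists (isotope Q (b, a, c)); last by rewrite mirror_isotope.
  by apply/orbitP; exists (b, a, c); rewrite ?inE.
Qed.

Fact mirror_class_subproof (c : isoclass) :
  mirror @: isoclass_set c \in [set isotopy_orbit Q | Q : quasigroup].
Proof.
by have /imsetP[Q _ ->] := isoclassP c; rewrite mirror_orbit; apply: imset_f.
Qed.

Definition mirror_class (c : isoclass) : isoclass :=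
  Isoclass (mirror_class_subproof c).

Lemma mirror_classE Q : mirror_class (isocl Q) = isocl (mirror Q).
Proof. by apply: val_inj; rewrite /= mirror_orbit. Qed.

Lemma mirror_classK : involutive mirror_class.
Proof.
case=> A HA; apply: val_inj; rewrite /= -imset_comp -[RHS]imset_id.
by apply: eq_imset => Q; apply: mirrorK.
Qed.

Definition isotopy_invariant (V : Type) (f : quasigroup -> V) : Prop :=
  forall g Q, f (isotopy Q g) = f Q.

Definition induced_operator (V : Type)
    (L : (quasigroup -> V) -> (quasigroup -> V))
    (Lbar : (isoclass -> V) -> (isoclass -> V)) : Prop :=
  forall fbar Q, Lbar fbar (isocl Q) = L (fbar \o isocl) Q.

End Quasigroups.

Section MarkovProcesses.
Local Open Scope classical_set_scope.
Local Open Scope ring_scope.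
Variables (R : realType) (S : finType).

Definition rate_generator (r : S -> S -> R) (f : S -> R) (x : S) : R :=
  \sum_(y : S) r x y * (f y - f x).

(* Transition functions [P] are indexed by all real [t], but only their values
   at [t >= 0] are meaningful. *)
Definition transition_semigroup (P : R -> S -> S -> R) : Prop :=
  [/\ forall t x y, 0 <= t -> 0 <= P t x y,
      forall t x, 0 <= t -> \sum_(y : S) P t x y = 1,
      forall x y, P 0 x y = (x == y)%:R
    & forall s t x z, 0 <= s -> 0 <= t ->
        P (s + t) x z = \sum_(y : S) P s x y * P t y z].

Definition has_generator (P : R -> S -> S -> R)
    (L : (S -> R) -> (S -> R)) : Prop :=
  forall f x,
    (fun t : R => t^-1 * (\sum_(y : S) P t x y * f y - f x)) @ 0^'+ --> L f x.

(* The equality is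
     Pr[Y_(t_(n+1)) = x_(n+1) | Y_(t_0) = x_0, ..., Y_(t_n) = x_n]
       = P_(t_(n+1) - t_n)(x_n, x_(n+1)),
   multiplied by the probability of the conditioning event, so that it is
   trivial when this event is null.  The initial law is arbitrary. *)
Definition markov_process (d : measure_display) (T : measurableType d)
    (Pr : probability T R) (Y : R -> T -> S) (P : R -> S -> S -> R) : Prop :=
  (forall t x, 0 <= t -> measurable [set w | Y t w = x]) /\
  (forall (n : nat) (t : nat -> R) (x : nat -> S),
    0 <= t 0%N -> (forall i, t i <= t i.+1) ->
    Pr [set w | forall i, (i <= n.+1)%N -> Y (t i) w = x i] =
    (Pr [set w | forall i, (i <= n)%N -> Y (t i) w = x i] *
     (P (t n.+1 - t n) (x n) (x n.+1))%:E)%E).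

End MarkovProcesses.

(* Main.v *)
Require Import Defs.
From HB Require Import structures.
From mathcomp Require Import all_boot all_order all_algebra all_fingroup.
From mathcomp Require Import all_classical all_reals all_analysis.

Set Implicit Arguments.
Unset Strict Implicit.
Unset Printing Implicit Defensive.

Import Order.TTheory GRing.Theory Num.Theory.
Import numFieldNormedType.Exports.
Local Open Scope ring_scope.

(** The process is not assumed to be an exponential of its generator, so no
    differential equation is solved: if [D t] measures the discrepancy between
    two stochastic semigroups with the same generator, then [D] is subadditive
    and [D h = o(h)] at [0^+], hence [D = 0].  Applied to [P t Q Q'] and
    [P t (g Q) (g Q')], this uniqueness turns the gauge invariance of the rates
    into that of the transition probabilities, so isotopy classes are lumpable
    (in the sense of Kemeny and Snell) and the process of classes is Markov.
    The same subadditivity argument shows that a function killed by the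
    generator is fixed by the semigroup; for the indicator of the complement of
    a mirror pair of classes, which vanishes on the pair, this gives confinement to that pair. *)

(** * Stochastic semigroups on a finite set: uniqueness and fixed functions *)

Section Semigroups.
Local Open Scope classical_set_scope.
Local Open Scope ring_scope.
Variables (R : realType) (S : finType).
Implicit Types (P : R -> S -> S -> R) (L : (S -> R) -> S -> R).

(* [B t b] stands for [D t <= b] with [D] subadditive; the relation avoids
   introducing the suprema that define [D]. *)
Lemma subadditive_bound (B : R -> R -> Prop) :
  B 0 0 ->
  (forall s t a b, 0 <= s -> 0 <= t -> B s a -> B t b -> B (s + t) (a + b)) ->
  (forall e, 0 < e -> \forall h \near 0^'+, B h (e * h)) ->
  forall t e, 0 <= t -> 0 < e -> exists2 b, b <= e & B t b.
Proof.
move=> B0 BD Bsmall t e'; rewrite le_eqVlt => /predU1P[<- e'0|t0 e'0].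
  by exists 0; rewrite // ltW.
exists e' => //.
pose e := e' / t.
have e0 : 0 < e by rewrite divr_gt0.
have -> : e' = e * t by rewrite divfK// gt_eqF.
have [del /= del0 Bdel] := Bsmall e e0.
(* Cut the time [t] into [n.+1] equal steps: truncation gives [t / del < n.+1], so each step [h] is
   below [del]. *)
pose n := Num.truncn (t / del).
pose h := t / n.+1%:R.
have h0 : 0 < h by rewrite divr_gt0.
have Bh : B h (e * h).
  apply: Bdel => //=; rewrite sub0r normrN gtr0_norm//.
  by rewrite ltr_pdivrMr// mulrC -ltr_pdivrMr// truncnS_gt.
have -> : t = n.+1%:R * h by rewrite mulrC divfK ?pnatr_eq0.
elim: n.+1 => [|m IHm]; first by rewrite !(mul0r, mulr0).
rewrite -addn1 natrD mulrDl mul1r mulrDr; apply: BD => //.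
- by rewrite mulr_ge0 // ltW.
- exact: ltW.
Qed.

(** First-order expansion at time 0; it is uniform in the state because finitely many limits share a
    neighbourhood. *)
Lemma generator_expansion P L f (e : R) : has_generator P L -> 0 < e ->
  \forall h \near 0^'+,
    forall x, `|\sum_y P h x y * f y - f x - h * L f x| <= e * h.
Proof.
move=> PL e0; apply: filter_forall => x.
have /cvgr_dist_le/(_ e e0) := PL f x.
apply: filterS2 (nbhs_right_gt 0) => h h0.
rewrite distrC => He; rewrite [e * h]mulrC -ler_pdivrMl//.
have /gtr0_norm hV : 0 < h^-1 by rewrite invr_gt0.
rewrite -[X in X * _]hV -normrM.
by rewrite mulrBr mulrA mulVf ?gt_eqF// mul1r.
Qed.

Lemma sum_delta (u : S -> R) y : \sum_z u z * (z == y)%:R = u y.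
Proof.
rewrite (bigD1 y)//= eqxx mulr1 big1 ?addr0// => z /negPf->.
by rewrite mulr0.
Qed.

(** The discrepancy is the largest row sum of |P_t - P'_t|. It is subadditive since P_s P_t - P'_s
    P'_t = (P_s - P'_s) P'_t + P_s (P_t - P'_t) and stochastic factors do not increase this norm. *)
Lemma semigroup_unique P P' L :
  transition_semigroup P -> transition_semigroup P' ->
  has_generator P L -> has_generator P' L ->
  forall t x y, 0 <= t -> P t x y = P' t x y.
Proof.
move=> [P0 P1 Pid PD] [P'0 P'1 P'id P'D] PL P'L.
pose B t b := forall x, \sum_y `|P t x y - P' t x y| <= b.
have B00 : B 0 0.
  by move=> x; rewrite big1// => y _; rewrite Pid P'id subrr normr0.
have BD s t a b : 0 <= s -> 0 <= t -> B s a -> B t b -> B (s + t) (a + b).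
  move=> s0 t0 Ba Bb x.
  pose G z := \sum_y (`|P s x y - P' s x y| * P' t y z +
                      P s x y * `|P t y z - P' t y z|).
  apply: (@le_trans _ _ (\sum_z G z)).
    apply: ler_sum => z _; rewrite PD// P'D// -sumrB.
    apply: (le_trans (ler_norm_sum _ _ _)); apply: ler_sum => y _.
    have -> : P s x y * P t y z - P' s x y * P' t y z =
        (P s x y - P' s x y) * P' t y z + P s x y * (P t y z - P' t y z).
      by rewrite mulrBl mulrBr [RHS]addrC addrA subrK.
    apply: (le_trans (ler_normD _ _)).
    by rewrite !normrM !(ger0_norm (P0 _ _ _ _), ger0_norm (P'0 _ _ _ _)).
  rewrite exchange_big/=.
  under eq_bigr do rewrite big_split/= -!mulr_sumr P'1// mulr1.
  rewrite big_split lerD//=.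
  apply: (@le_trans _ _ (\sum_y P s x y * b)).
    by apply: ler_sum => y _; rewrite ler_wpM2l// P0.
  by rewrite -mulr_suml P1// mul1r.
have Bsmall e : 0 < e -> \forall h \near 0^'+, B h (e * h).
  (* Expanding both semigroups on point indicators cancels the common linear term, leaving an error
     [2 * e' * h] for each of the #|S| entries of a row; the successor keeps the denominator
     positive. *)
  move=> e0; pose e' := e / (2 * #|S|.+1%:R).
  have e'0 : 0 < e' by rewrite divr_gt0// mulr_gt0.
  have E1 : \forall h \near 0^'+, forall y x,
      `|\sum_z P h x z * (z == y)%:R - (x == y)%:R
        - h * L (fun z => (z == y)%:R) x| <= e' * h.
    by apply: filter_forall => y; exact: generator_expansion.
  have E2 : \forall h \near 0^'+, forall y x,
      `|\sum_z P' h x z * (z == y)%:R - (x == y)%:R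
        - h * L (fun z => (z == y)%:R) x| <= e' * h.
    by apply: filter_forall => y; exact: generator_expansion.
  apply: filterS3 (nbhs_right_gt 0) E1 E2 => h h0 H1 H2 x.
  apply: (@le_trans _ _ (\sum_(y : S) (2 * e' * h))).
    apply: ler_sum => y _; move: (H1 y x) (H2 y x); rewrite !sum_delta.
    set c := h * _ => {}H1 {}H2.
    have -> : P h x y - P' h x y = (P h x y - (x == y)%:R - c)
                                 - (P' h x y - (x == y)%:R - c).
      by rewrite !opprB addrA subrK addrA subrK.
    apply: (le_trans (ler_normB _ _)).
    by rewrite -mulrA [2 * _]mulr_natl mulr2n lerD.
  rewrite sumr_const -[leLHS]mulr_natl mulrA ler_wpM2r ?(ltW h0)//.
  rewrite /e' invfM [2 * (e * _)]mulrCA mulVKf ?pnatr_eq0//.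
  by rewrite mulrCA ger_pMr// ler_pdivrMr// mul1r ler_nat.
move=> t x y t0; apply/eqP; rewrite -subr_eq0 -normr_le0.
apply/ler_addgt0Pr => e e0; rewrite add0r.
have [b be Bb] := subadditive_bound B00 BD Bsmall t0 e0.
apply: le_trans be; apply: le_trans (Bb x).
by rewrite (bigD1 y)//= lerDl sumr_ge0.
Qed.

(** The discrepancy is the maximum of |P_t f - f|, subadditive by P_(s+t) f - f = (P_s f - f) + P_s
    (P_t f - f); its expansion at 0 has no linear term because [L f] vanishes. *)
Lemma generator_kernel_fixed P L f :
  transition_semigroup P -> has_generator P L -> (forall x, L f x = 0) ->
  forall t x, 0 <= t -> \sum_y P t x y * f y = f x.
Proof.
move=> [P0 P1 Pid PD] PL Lf.
pose B t b := forall x, `|\sum_y P t x y * f y - f x| <= b.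
have B00 : B 0 0.
  move=> x; rewrite (eq_bigr (fun y => f y * (y == x)%:R)).
    by rewrite sum_delta subrr normr0.
  by move=> y _; rewrite Pid mulrC eq_sym.
have BD s t a b : 0 <= s -> 0 <= t -> B s a -> B t b -> B (s + t) (a + b).
  move=> s0 t0 Ba Bb x.
  have -> : \sum_y P (s + t) x y * f y - f x =
      (\sum_y P s x y * f y - f x) +
      \sum_y P s x y * (\sum_z P t y z * f z - f y).
    under [X in _ = _ + X]eq_bigr do rewrite mulrBr mulr_sumr.
    rewrite sumrB [RHS]addrC addrA subrK.
    rewrite exchange_big/=; congr (_ - _); apply: eq_bigr => z _.
    by rewrite PD// mulr_suml; apply: eq_bigr => y _; rewrite mulrA.
  apply: (le_trans (ler_normD _ _)); rewrite lerD//.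
  apply: (le_trans (ler_norm_sum _ _ _)).
  apply: (@le_trans _ _ (\sum_y P s x y * b)).
    by apply: ler_sum => y _; rewrite normrM ger0_norm ?P0// ler_wpM2l// P0.
  by rewrite -mulr_suml P1// mul1r.
have Bsmall e : 0 < e -> \forall h \near 0^'+, B h (e * h).
  move=> e0; apply: filterS (generator_expansion f PL e0) => h H x.
  by move: (H x); rewrite Lf mulr0 subr0.
move=> t x t0; apply/eqP; rewrite -subr_eq0 -normr_le0.
apply/ler_addgt0Pr => e e0; rewrite add0r.
have [b be Bb] := subadditive_bound B00 BD Bsmall t0 e0.
exact: le_trans (Bb x) be.
Qed.

End Semigroups.

(** * Markov processes observed through a map of finite state spaces *)

Section Lumping.
Local Open Scope classical_set_scope.
Local Open Scope ring_scope.
Variables (R : realType) (d : measure_display) (T : measurableType d).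
Variable Pr : probability T R.

Lemma finite_valued_bigcup (I : finType) (Z : T -> I) (A : pred I) :
  [set w | A (Z w)] = \bigcup_(i in [set` A]) [set w | Z w = i].
Proof. by apply/seteqP; split=> [w Aw|w [i Ai] /= ->//]; exists (Z w). Qed.

Lemma measurable_finite_valued (I : finType) (Z : T -> I) (A : pred I) :
  (forall i, measurable [set w | Z w = i]) -> measurable [set w | A (Z w)].
Proof.
move=> mZ; rewrite finite_valued_bigcup.
by apply: fin_bigcup_measurable => // i _.
Qed.

Lemma measure_finite_valued (I : finType) (Z : T -> I) (A : pred I) :
  (forall i, measurable [set w | Z w = i]) ->
  Pr [set w | A (Z w)] = (\sum_(i | A i) Pr [set w | Z w = i])%E.
Proof.
move=> mZ; rewrite finite_valued_bigcup.
rewrite measure_fin_bigcup//; last first.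
  by move=> i j _ _ [w [/= -> ->]].
rewrite (fsbigE (enum A)) ?enum_uniq//.
- rewrite big_enum_cond/=; apply: eq_bigl => i.
  by rewrite mem_setE andbb.
- by move=> i /=; rewrite mem_enum.
- by move=> i /= Ai; rewrite mem_enum Ai.
Qed.

Lemma measurable_history (S : finType) (Y : R -> T -> S) (P : R -> S -> S -> R)
    (n : nat) (t : nat -> R) (x : nat -> S) :
  markov_process Pr Y P -> (forall i, 0 <= t i) ->
  measurable [set w | forall i, (i <= n)%N -> Y (t i) w = x i].
Proof.
move=> [mY _] t0.
have -> : [set w | forall i, (i <= n)%N -> Y (t i) w = x i] =
    \bigcap_(i in [set i | (i <= n)%N]) [set w | Y (t i) w = x i].
  by apply/seteqP; split=> w H i /H.
by apply: bigcap_measurableType => i _; exact: mY.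
Qed.

(* The past up to step [n] is the single finite-valued variable [h], so the
   coarse cylinder events are sums of exact ones, to which the Markov property
   applies. *)
Lemma markov_lumping (S C : finType) (pi : S -> C) (Y : R -> T -> S)
    (P : R -> S -> S -> R) (Pbar : R -> C -> C -> R) :
  markov_process Pr Y P ->
  (forall t x c, 0 <= t -> Pbar t (pi x) c = \sum_(y | pi y == c) P t x y) ->
  markov_process Pr (fun t w => pi (Y t w)) Pbar.
Proof.
move=> YP lump; have [mY markovY] := YP; split.
  move=> t c t0.
  have -> : [set w | pi (Y t w) = c] = [set w | pi (Y t w) == c].
    by apply/seteqP; split=> w /= /eqP.
  by apply: (measurable_finite_valued (fun x => pi x == c)) => x; exact: mY.
move=> n t c t00 tle.
have t0 i : 0 <= t i by elim: i => // i IH; exact: le_trans (tle i).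
pose h w : {ffun 'I_n.+1 -> S} := [ffun i : 'I_n.+1 => Y (t i) w].
pose pasts (x : {ffun 'I_n.+1 -> S}) := [forall i, pi (x i) == c i].
have hE x : [set w | h w = x] =
    [set w | forall i, (i <= n)%N -> Y (t i) w = x (inord i)].
  apply/seteqP; split=> w /=.
    by move=> <- i ni; rewrite ffunE inordK.
  by move=> H; apply/ffunP => i; rewrite ffunE H ?inord_val// -ltnS.
have mh x : measurable [set w | h w = x].
  by rewrite hE; apply: measurable_history YP t0.
(* The Markov property expects a path indexed by all naturals: it takes the value [y] from index
   [n.+1] on. *)
have hyE x y : [set w | (h w, Y (t n.+1) w) = (x, y)] =
    [set w | forall i, (i <= n.+1)%N ->
       Y (t i) w = if (i <= n)%N then x (inord i) else y].
  apply/seteqP; split=> w /=.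
    move=> [<- <-] i i_n; case: (leqP i n) => ni; first by rewrite ffunE inordK.
    by have -> : i = n.+1 by apply/eqP; rewrite eqn_leq i_n.
  move=> H; congr pair; last by rewrite H// ltnn.
  apply/ffunP => i; rewrite ffunE H; last exact: ltnW.
  by rewrite -ltnS ltn_ord inord_val.
pose future (p : {ffun 'I_n.+1 -> S} * S) := pasts p.1 && (pi p.2 == c n.+1).
have -> : [set w | forall i, (i <= n.+1)%N -> pi (Y (t i) w) = c i] =
    [set w | future (h w, Y (t n.+1) w)].
  apply/seteqP; split=> w /=.
    move=> H; apply/andP; split; last by rewrite H.
    by apply/forallP => i; rewrite ffunE H// ltnW.
  move=> /andP[/forallP H /eqP Hn] i; rewrite leq_eqVlt => /predU1P[->//|ni].
  by have := H (Ordinal ni); rewrite ffunE => /eqP.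
have -> : [set w | forall i, (i <= n)%N -> pi (Y (t i) w) = c i] =
    [set w | pasts (h w)].
  apply/seteqP; split=> w /=.
    by move=> H; apply/forallP => i; rewrite ffunE H// -ltnS.
  move=> /forallP H i; rewrite -ltnS => ni.
  by have := H (Ordinal ni); rewrite ffunE => /eqP.
rewrite (measure_finite_valued pasts mh).
rewrite (measure_finite_valued future); last first.
  by move=> [x y]; rewrite hyE; apply: measurable_history YP t0.
transitivity (\sum_(x | pasts x) \sum_(y | pi y == c n.+1)
    Pr [set w | (h w, Y (t n.+1) w) = (x, y)])%E.
  by rewrite pair_big; apply: eq_bigr => -[].
rewrite ge0_sume_distrl//; apply: eq_bigr => x /forallP xc.
(* Every past compatible with [c] ends in the class [c n], so [lump] expands the common factor into
   transitions from the actual last state of that past. *)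
have -> : c n = pi (x ord_max) by have /eqP := xc ord_max.
rewrite lump ?subr_ge0// -(fineK (fin_num_measure Pr _ (mh x))).
rewrite -EFinM mulr_sumr -sumEFin; apply: eq_bigr => y _.
rewrite hyE markovY// ltnn leqnn EFinM fineK ?fin_num_measure// hE.
have -> : inord n = ord_max :> 'I_n.+1 by apply: val_inj; rewrite /= inordK.
congr (Pr _ * _)%E.
by apply/seteqP; split=> w H i ni; rewrite H// ni.
Qed.

(** Only finitely many pairs of states violate [E], and the Markov property gives each of them
    probability 0. *)
Lemma markov_two_times_null (S : finType) (Y : R -> T -> S)
    (P : R -> S -> S -> R) (E : rel S) (s t : R) :
  markov_process Pr Y P -> 0 <= s -> s <= t ->
  (forall x y, ~~ E x y -> P (t - s) x y = 0) ->
  {ae Pr, forall w, E (Y s w) (Y t w)}.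
Proof.
move=> YP s0 st PE.
(* Only indices 0 and 1 are observed; repeating [t] keeps the sequence of times nondecreasing. *)
pose u i := if i is 0%N then s else t.
have u0 i : 0 <= u i by case: i => //= _; exact: le_trans st.
have YE x y : [set w | (Y s w, Y t w) = (x, y)] =
    [set w | forall i, (i <= 1)%N -> Y (u i) w = if i is 0%N then x else y].
  apply/seteqP; split=> w /=; first by move=> [<- <-] [|[|]].
  by move=> H; rewrite -(H 0%N)// -(H 1%N).
have mYY p : measurable [set w | (Y s w, Y t w) = p].
  by case: p => x y; rewrite YE; apply: measurable_history YP u0.
pose N p := ~~ E p.1 p.2.
exists [set w | N (Y s w, Y t w)]; split.
- exact: (measurable_finite_valued N).
- rewrite (measure_finite_valued N)// big1// => -[x y] /PE Pxy.
  rewrite YE; have [_ ->//] := YP; last by case=> //=.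
  by rewrite /= Pxy mule0.
- by move=> w /= /negP.
Qed.

End Lumping.

(** * Semigroup and generator of the lumped process *)

Section LumpedSemigroup.
Local Open Scope classical_set_scope.
Local Open Scope ring_scope.
Variables (R : realType) (S C : finType) (pi : S -> C).
Variables (P : R -> S -> S -> R) (Pbar : R -> C -> C -> R).
Hypothesis pi_surj : forall c, exists x, pi x = c.
Hypothesis lump : forall t x c, 0 <= t ->
  Pbar t (pi x) c = \sum_(y | pi y == c) P t x y.

(** Grouping states by fibre shows that composition with [pi] intertwines the two semigroups; the
    semigroup law and the generator of [Pbar] follow from this. *)
Lemma sum_lumped (f : C -> R) t x : 0 <= t ->
  \sum_c Pbar t (pi x) c * f c = \sum_y P t x y * f (pi y).
Proof.
move=> t0; rewrite [RHS](partition_big pi xpredT)//=; apply: eq_bigr => c _.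
by rewrite lump// mulr_suml; apply: eq_bigr => y /eqP <-.
Qed.

Lemma lumped_semigroup : transition_semigroup P -> transition_semigroup Pbar.
Proof.
move=> [P0 P1 Pid PD]; split.
- move=> t c c' t0; have [x <-] := pi_surj c.
  by rewrite lump// sumr_ge0// => y _; exact: P0.
- move=> t c t0; have [x <-] := pi_surj c; rewrite -(P1 t x t0).
  have := sum_lumped (fun=> 1) x t0.
  by under eq_bigr do rewrite mulr1; under [in RHS]eq_bigr do rewrite mulr1.
- move=> c c'; have [x <-] := pi_surj c; rewrite lump//.
  under eq_bigr do rewrite Pid.
  have [<-|xc'] := eqVneq (pi x) c'; last first.
    rewrite big1// => y /eqP yc'; case: eqVneq => // xy.
    by rewrite xy yc' eqxx in xc'.
  rewrite (bigD1 x)//= eqxx big1 ?addr0// => y /andP[_].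
  by rewrite eq_sym => /negPf->.
- move=> s t c c'' s0 t0; have [x <-] := pi_surj c.
  rewrite lump ?addr_ge0//.
  under eq_bigr do rewrite PD//.
  rewrite exchange_big/= (sum_lumped (fun c' => Pbar t c' c''))//.
  by apply: eq_bigr => y _; rewrite lump// mulr_sumr.
Qed.

Lemma lumped_generator (L : (S -> R) -> S -> R) (Lbar : (C -> R) -> C -> R) :
  (forall fbar x, Lbar fbar (pi x) = L (fbar \o pi) x) ->
  has_generator P L -> has_generator Pbar Lbar.
Proof.
move=> LbarE PL fbar c; have [x <-] := pi_surj c; rewrite LbarE.
apply: cvg_trans (PL (fbar \o pi) x); apply: near_eq_cvg.
(* The two difference quotients agree for [t >= 0], which suffices for a right limit at 0. *)
by apply: filterS (nbhs_right_ge 0) => t t0; rewrite sum_lumped.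
Qed.

End LumpedSemigroup.

(** * Isotopy and mirror symmetry of rates and transition probabilities *)

Section Isotopy.
Variable X : finType.
Implicit Types Q : quasigroup X.

Lemma mem_isotopy_orbit Q Q' :
  (Q' \in isotopy_orbit Q) = (isocl Q' == isocl Q).
Proof.
by rewrite -(inj_eq val_inj) /= -orbit_eq_mem eq_sym.
Qed.

Lemma isocl_isotopy Q g : isocl (isotopy X Q g) = isocl Q.
Proof.
by apply/eqP; rewrite -mem_isotopy_orbit; apply: mem_orbit; rewrite inE.
Qed.

Lemma isocl_surj (c : isoclass X) : exists Q, isocl Q = c.
Proof.
by case: c => A cA; have /imsetP[Q _ AQ] := cA; exists Q; apply: val_inj.
Qed.

Variable R : realType.
Variable r : quasigroup X -> quasigroup X -> R.
Hypothesis gauge_invariance :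
  forall g Q Q', r (isotopy X Q g) (isotopy X Q' g) = r Q Q'.

Hypothesis mirror_only :
  forall Q Q', Q' \notin isotopy_orbit (mirror Q) -> r Q Q' = 0.

(** An isotopy permutes the target states, so gauge invariance makes the generator commute with the
    action on functions. *)
Lemma rate_generator_isotopy f g Q :
  rate_generator r f (isotopy X Q g) =
  rate_generator r (fun Q' => f (isotopy X Q' g)) Q.
Proof.
rewrite /rate_generator (reindex_inj (act_inj (isotopy X) g)).
by apply: eq_bigr => Q' _; rewrite gauge_invariance.
Qed.

Lemma semigroup_isotopy P : transition_semigroup P ->
  has_generator P (rate_generator r) ->
  forall g t Q Q', 0 <= t ->
    P t (isotopy X Q g) (isotopy X Q' g) = P t Q Q'.
Proof.
move=> PS PL g; have [P0 P1 Pid PD] := PS.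
apply: (semigroup_unique
  (P := fun t Q Q' => P t (isotopy X Q g) (isotopy X Q' g)) _ PS _ PL).
- split.
  + by move=> t Q Q'; exact: P0.
  + move=> t Q t0; rewrite -(P1 t (isotopy X Q g) t0).
    by rewrite [RHS](reindex_inj (act_inj (isotopy X) g)).
  + by move=> Q Q'; rewrite Pid (inj_eq (act_inj _ _)).
  + move=> s t Q Q' s0 t0; rewrite PD//.
    by rewrite (reindex_inj (act_inj (isotopy X) g)).
(* Pulling [f] back by the inverse of [g] turns the limit for [P] at the image of [Q] into the limit
   for the conjugated semigroup at [Q]. *)
- move=> f Q; pose f' Q' := f (isotopy X Q' g^-1%g).
  have f'E Q' : f' (isotopy X Q' g) = f Q' by rewrite /f' actK.
  have := PL f' (isotopy X Q g); rewrite rate_generator_isotopy f'E.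
  under [in rate_generator _ _]eq_fun do rewrite f'E.
  apply: cvg_trans; apply: near_eq_cvg; apply: nearW => t.
  rewrite [in LHS](reindex_inj (act_inj (isotopy X) g))/=.
  by under [in LHS]eq_bigr do rewrite f'E.
Qed.

(** The lumpability condition: an isotopy taking [Q1] to [Q] preserves every class, hence permutes
    the terms of the sum. *)
Lemma isoclass_transition_lump P : transition_semigroup P ->
  has_generator P (rate_generator r) ->
  forall t Q Q1 c, 0 <= t -> isocl Q = isocl Q1 ->
    \sum_(Q' | isocl Q' == c) P t Q Q' = \sum_(Q' | isocl Q' == c) P t Q1 Q'.
Proof.
move=> PS PL t Q Q1 c t0 /eqP; rewrite -mem_isotopy_orbit => /orbitP[g _ <-].
rewrite (reindex_inj (act_inj (isotopy X) g)).
by apply: eq_big => Q'; rewrite ?isocl_isotopy// semigroup_isotopy.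
Qed.

Lemma semigroup_mirror_pair P : transition_semigroup P ->
  has_generator P (rate_generator r) ->
  forall t Q Q', 0 <= t ->
    isocl Q' != isocl Q -> isocl Q' != isocl (mirror Q) -> P t Q Q' = 0.
Proof.
move=> PS PL t Q Q' t0 Q'1 Q'2; have [P0 _ _ _] := PS.
pose out c : R := ((c != isocl Q) && (c != isocl (mirror Q)))%:R.
have out_mirror c : out (mirror_class c) = out c.
  rewrite /out -mirror_classE (inj_eq (can_inj (@mirror_classK X))).
  rewrite -{1}(mirror_classK (isocl Q)) (inj_eq (can_inj (@mirror_classK X))).
  by rewrite andbC.
(* A jump of nonzero rate leads to the mirror class, where [out] has the same value. *)
have Lout Q1 : rate_generator r (out \o @isocl X) Q1 = 0.
  apply: big1 => Q2 _.
  have [|/mirror_only->] := boolP (Q2 \in isotopy_orbit (mirror Q1));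
    last by rewrite mul0r.
  rewrite mem_isotopy_orbit /= => /eqP->.
  by rewrite -mirror_classE out_mirror subrr mulr0.
(* The mean of [out] under [P t Q] equals its value 0 at [Q]; all terms are nonnegative, so the term
   at [Q'], where [out] is 1, vanishes. *)
have := generator_kernel_fixed PS PL Lout Q t0.
rewrite /= {2}/out eqxx/= => /psumr_eq0P/(_ Q' isT).
rewrite /out Q'1 Q'2 mulr1; apply=> Q2 _.
by rewrite mulr_ge0// P0.
Qed.

End Isotopy.

(** * The induced process on isotopy classes *)

Theorem theorem2p6 (R : realType) (X : finType)
  (r : quasigroup X -> quasigroup X -> R)
  (P : R -> quasigroup X -> quasigroup X -> R)
  (d : measure_display) (T : measurableType d) (Pr : probability T R)
  (Qt : R -> T -> quasigroup X)
  (k : isoclass X -> R)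
  (r_ge0 : forall Q Q', 0 <= r Q Q')
  (P_semigroup : transition_semigroup P)
  (P_generator : has_generator P (rate_generator r))
  (Qt_markov : markov_process Pr Qt P)
  (gauge_invariance : forall g Q Q', r (isotopy X Q g) (isotopy X Q' g) = r Q Q')
  (mirror_only : forall Q Q', Q' \notin isotopy_orbit (mirror Q) -> r Q Q' = 0)
  (class_rate : forall Q,
     k (isocl Q) = \sum_(Q' in isotopy_orbit (mirror Q)) r Q Q') :
  (forall f : quasigroup X -> R,
     isotopy_invariant f -> isotopy_invariant (rate_generator r f)) /\
  exists (Lbar : (isoclass X -> R) -> (isoclass X -> R))
         (Pbar : R -> isoclass X -> isoclass X -> R),
    [/\ induced_operator (rate_generator r) Lbar
        /\ (forall fbar Q, Lbar fbar (isocl Q) =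
              k (isocl Q) * (fbar (isocl (mirror Q)) - fbar (isocl Q))),
        forall t Q c, 0 <= t ->
          Pbar t (isocl Q) c = \sum_(Q' | isocl Q' == c) P t Q Q',
        [/\ transition_semigroup Pbar, has_generator Pbar Lbar
          & markov_process Pr (fun t w => isocl (Qt t w)) Pbar],
        forall t Q c, 0 <= t ->
          c != isocl Q -> c != isocl (mirror Q) -> Pbar t (isocl Q) c = 0
      & forall s t, 0 <= s -> s <= t ->
          {ae Pr, forall w, isocl (Qt t w) = isocl (Qt s w)
                         \/ isocl (Qt t w) = isocl (mirror (Qt s w))}].
Proof.
have lumpS := isoclass_transition_lump gauge_invariance P_semigroup P_generator.
split.
  move=> f f_inv g Q; rewrite rate_generator_isotopy//.
  by apply: eq_bigr => Q' _; rewrite !f_inv.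
pose rep c := projT1 (cid (@isocl_surj X c)).
have repK c : isocl (rep c) = c by rewrite /rep; case: cid.
pose Pbar t c c' := \sum_(Q' | isocl Q' == c') P t (rep c) Q'.
pose Lbar (fbar : isoclass X -> R) c :=
  k c * (fbar (mirror_class c) - fbar c).
have lump t Q c : 0 <= t ->
    Pbar t (isocl Q) c = \sum_(Q' | isocl Q' == c) P t Q Q'.
  by move=> t0; apply: lumpS; rewrite ?repK.
have LbarE : induced_operator (rate_generator r) Lbar.
  move=> fbar Q; rewrite /Lbar mirror_classE class_rate mulr_suml.
  (* Off the mirror orbit the rates vanish; on it [fbar] is constant, so the rates add up to [k]. *)
  rewrite /rate_generator [RHS](bigID (mem (isotopy_orbit (mirror Q))))/=.
  rewrite [X in _ = _ + X]big1 ?addr0 => [|Q' /mirror_only->];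
    last by rewrite mul0r.
  by apply: eq_bigr => Q'; rewrite mem_isotopy_orbit => /eqP->.
have out := semigroup_mirror_pair mirror_only P_semigroup P_generator.
exists Lbar, Pbar; split=> //.
- by split=> // fbar Q; rewrite /Lbar mirror_classE.
- split.
  + exact: lumped_semigroup (@isocl_surj X) lump P_semigroup.
  + exact: (lumped_generator (@isocl_surj X) lump LbarE P_generator).
  + exact: markov_lumping Qt_markov lump.
- move=> t Q c t0 cQ cmQ; rewrite lump// big1// => Q' /eqP Q'c.
  by apply: out; rewrite ?Q'c.
- move=> s t s0 st.
  (* Confinement of the transition probabilities over the duration [t - s] becomes an almost sure
     statement about the pair of states at times [s] and [t]. *)
  pose E (Q Q' : quasigroup X) :=
    (isocl Q' == isocl Q) || (isocl Q' == isocl (mirror Q)).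
  have EP Q Q' : ~~ E Q Q' -> P (t - s) Q Q' = 0.
    by rewrite negb_or => /andP[]; apply: out; rewrite subr_ge0.
  apply: filterS (markov_two_times_null Qt_markov s0 st EP) => w.
  by move=> /orP[] /eqP; [left|right].
Qed.
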